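(* Let $A\in\mathbb{R}^{n\times d}$ be a standardized matrix (every row has Euclidean norm $1$) and $b\in\mathbb{R}^n$, where the first $n_e$ rows of $A$ (forming $A_=$) correspond to equalities and the remaining $n_i=n-n_e$ rows (forming $A_\le$) correspond to inequalities, i.e. the system is $\langle a_i,x\rangle=b_i$ for $i\le n_e$ and $\langle a_i,x\rangle\le b_i$ for $n_e<i\le n$. Assume that the feasible set $S\subseteq\mathbb{R}^d$ of this system is non-empty. Let $T=\{\tau_1,\dots,\tau_m\}$ be an $(m,\beta)$ row paving of $A_=$, and let $x_0\in\mathbb{R}^d$ be arbitrary. Let $x_1,x_2,\dots$ be the random iterates of the block Kaczmarz method for a system of inequalities, run with $A$, $b$, $T$, $\beta$ and initial iterate $x_0$ (as defined in the context). Then for each $j=1,2,3,\dots$, $$\mathbb{E}\left[d(x_j,S)^2\right]\le\left(1-\frac{1}{L^2(n_i+\beta m)}\right)^j d(x_0,S)^2,$$ where $L$ is the Hoffman constant of the system.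
   Context: Notation. $a_i$ is the $i$-th row of $A$ (viewed as a vector), $I_==\{1,\dots,n_e\}$, $I_\le=\{n_e+1,\dots,n\}$. $d(x,S)$ is the Euclidean distance from $x$ to $S$. For an index set $\tau$, $A_\tau$ is the row submatrix of $A$ and $b_\tau$ the subvector of $b$ indexed by $\tau$; $A_\tau^\dagger$ is the Moore–Penrose pseudoinverse. $t^+=\max(t,0)$. The function $e:\mathbb{R}^n\to\mathbb{R}^n$ is $e(y)_i=y_i^+$ for $i\in I_\le$ and $e(y)_i=y_i$ for $i\in I_=$. Row paving. An $(m,\beta)$ row paving of a matrix $M$ is a partition $\{\tau_1,\dots,\tau_m\}$ of its row indices into $m$ blocks such that $\lambda_{\max}(M_\tau M_\tau^* )\le\beta$ for each block $\tau$. Hoffman constant. $L$ is a constant, independent of $b$, such that whenever the feasible set $S$ is non-empty, $d(x,S)\le L\,\|e(Ax-b)\|_2$ for all $x\in\mathbb{R}^d$ (such a constant exists by a lemma of Hoffman). Block Kaczmarz method for a system of inequalities. At each iteration $j\ge1$, with all random choices independent of previous iterations: with probability $p=\frac{\beta m}{n_i+\beta m}$, choose a block $\tau$ uniformly at random from $T$ and set $x_j=x_{j-1}+A_\tau^\dagger(b_\tau-A_\tau x_{j-1})$; otherwise (with probability $1-p$), choose a row index $i$ uniformly at random from $\{n_e+1,\dots,n\}$ and set $x_j=x_{j-1}-\frac{(\langle a_i,x_{j-1}\rangle-b_i)^+}{\|a_i\|_2^2}\,a_i$. The iteration is considered as an infinite sequence (no stopping rule). *)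

(* Defs.v *)
From mathcomp Require Import all_boot all_order all_algebra.
From mathcomp Require Import all_classical all_reals all_analysis.

Set Implicit Arguments.
Unset Strict Implicit.
Unset Printing Implicit Defensive.

Import Order.TTheory GRing.Theory Num.Theory.

Local Open Scope ring_scope.

(* MathComp-Analysis equips matrices with the sup norm, so the Euclidean norm
   and the distance it induces are defined here. *)
Definition norm2 (R : realType) (k : nat) (x : 'cV[R]_k) : R :=
  Num.sqrt (\sum_(i < k) x i ord0 ^+ 2).

(* For S = set0 the value is the junk value inf set0 = 0. *)
Definition dist2 (R : realType) (k : nat) (x : 'cV[R]_k) (S : set 'cV[R]_k) : R :=
  inf [set norm2 (x - y) | y in S]%classic.

Definition standardized (R : realType) (n d : nat) (A : 'M[R]_(n, d)) : Prop :=
  forall i : 'I_n, norm2 (row i A)^T = 1.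

Definition rowblock (R : realType) (n d : nat) (tau : {set 'I_n})
    (M : 'M[R]_(n, d)) : 'M[R]_(#|tau|, d) :=
  rowsub (fun k : 'I_#|tau| => enum_val k) M.

(* Intended for symmetric M of positive size; the supremum is then attained. *)
Definition lambda_max (R : realType) (k : nat) (M : 'M[R]_k) : R :=
  sup [set a : R | eigenvalue M a]%classic.

(* The four Penrose equations, for real matrices. *)
Definition penrose (R : realType) (n d : nat) (M : 'M[R]_(n, d))
    (X : 'M[R]_(d, n)) : Prop :=
  [/\ M *m X *m M = M, X *m M *m X = X,
      (M *m X)^T = M *m X & (X *m M)^T = X *m M].

(* MathComp's pinvmx is only some partial inverse.  The choice below is
   well defined by penrose_ex and penrose_uniq. *)
Definition mp_pinv (R : realType) (n d : nat) (M : 'M[R]_(n, d)) : 'M[R]_(d, n) :=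
  xget 0 [set X | penrose M X]%classic.

Lemma gram_unit (R : realType) (r d : nat) (F : 'M[R]_(r, d)) :
  row_free F -> F *m F^T \in unitmx.
Proof.
move=> Ff; rewrite -row_free_unit -kermx_eq0; apply/eqP/row_matrixP => i.
set v := row i _.
have vK : v *m (F *m F^T) = 0 by rewrite -row_mul mulmx_ker row0.
suff vF : v *m F = 0 by apply: (row_free_inj Ff); rewrite row0 vF mul0mx.
have : (v *m F) *m (v *m F)^T = 0.
  by rewrite trmx_mul -!mulmxA (mulmxA F) mulmxA vK mul0mx.
move: (v *m F) => u /matrixP/(_ 0 0); rewrite !mxE => /eqP.
rewrite psumr_eq0 => [/allP h|j _]; last by rewrite !mxE -expr2 sqr_ge0.
apply/rowP => j; have /= := h j (mem_index_enum j).
by rewrite !mxE mulf_eq0 orbb => /eqP.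
Qed.

Lemma penrose_full_rank (R : realType) (n r d : nat)
    (C : 'M[R]_(n, r)) (F : 'M[R]_(r, d)) :
  F *m F^T \in unitmx -> C^T *m C \in unitmx ->
  penrose (C *m F) (F^T *m invmx (F *m F^T) *m (invmx (C^T *m C) *m C^T)).
Proof.
move=> uF uC.
have sF : (invmx (F *m F^T))^T = invmx (F *m F^T).
  by rewrite trmx_inv trmx_mul trmxK.
have sC : (invmx (C^T *m C))^T = invmx (C^T *m C).
  by rewrite trmx_inv trmx_mul trmxK.
have FG : F *m (F^T *m invmx (F *m F^T)) = 1%:M by rewrite mulmxA mulmxV.
have KC : invmx (C^T *m C) *m C^T *m C = 1%:M by rewrite -mulmxA mulVmx.
set H := F^T *m _ in FG *; set D := invmx (C^T *m C) *m _ in KC *.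
have MX : C *m F *m (H *m D) = C *m D by rewrite mulmxA -(mulmxA C) FG mulmx1.
have XM : H *m D *m (C *m F) = H *m F by rewrite mulmxA -(mulmxA H) KC mulmx1.
split; rewrite ?MX ?XM.
- by rewrite mulmxA -(mulmxA C) KC mulmx1.
- by rewrite mulmxA -(mulmxA H) FG mulmx1.
- by rewrite /D !trmx_mul trmxK sC mulmxA.
- by rewrite /H !trmx_mul trmxK sF mulmxA.
Qed.

Lemma penrose_ex (R : realType) (n d : nat) (M : 'M[R]_(n, d)) :
  exists X, penrose M X.
Proof.
rewrite -{1}(mulmx_base M); eexists; apply: penrose_full_rank.
  exact/gram_unit/row_base_free.
rewrite -[X in _ *m X]trmxK; apply: gram_unit.
by rewrite /row_free mxrank_tr; apply: col_base_full.
Qed.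

Lemma penrose_uniq (R : realType) (n d : nat) (M : 'M[R]_(n, d)) X Y :
  penrose M X -> penrose M Y -> X = Y.
Proof.
case=> [X1 X2 X3 X4] [Y1 Y2 Y3 Y4].
have e1 : M *m X = M *m Y.
  by rewrite -X3 -{1}Y1 -(mulmxA (M *m Y)) trmx_mul X3 Y3 mulmxA X1.
have e2 : X *m M = Y *m M.
  by rewrite -X4 -{1}Y1 -(mulmxA M) mulmxA trmx_mul Y4 X4 -mulmxA (mulmxA M) X1.
by rewrite -X2 e2 -mulmxA e1 mulmxA Y2.
Qed.

Lemma mp_pinvP (R : realType) (n d : nat) (M : 'M[R]_(n, d)) :
  penrose M (mp_pinv M).
Proof. exact: xgetPex (penrose_ex M). Qed.

(* finset's partition requires the blocks to be non-empty. *)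
Definition row_paving (R : realType) (n d : nat) (M : 'M[R]_(n, d))
    (m : nat) (beta : R) (T : {set {set 'I_n}}) : Prop :=
  [/\ finset.partition T [set: 'I_n]%SET,
      #|T| = m
    & forall tau : {set 'I_n}, tau \in T ->
        lambda_max (rowblock tau M *m (rowblock tau M)^T) <= beta].

(* In a system with ne equalities and ni inequalities the equality rows of
   A : 'M_(ne + ni, d) are usubmx A and the inequality rows are dsubmx A. *)
Definition feasible_set (R : realType) (ne ni d : nat)
    (A : 'M[R]_(ne + ni, d)) (b : 'cV[R]_(ne + ni)) : set 'cV[R]_d :=
  [set x | (forall i : 'I_ne, (A *m x) (lshift ni i) ord0 = b (lshift ni i) ord0) /\
           (forall i : 'I_ni, (A *m x) (rshift ne i) ord0 <= b (rshift ne i) ord0)]%classic.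

Definition residual (R : realType) (ne ni : nat) (y : 'cV[R]_(ne + ni)) :
    'cV[R]_(ne + ni) :=
  col_mx (usubmx y) (map_mx (fun t : R => Num.max t 0) (dsubmx y)).

(* L works simultaneously for every right-hand side. *)
Definition hoffman_constant (R : realType) (ne ni d : nat)
    (A : 'M[R]_(ne + ni, d)) (L : R) : Prop :=
  forall b : 'cV[R]_(ne + ni), (feasible_set A b !=set0)%classic ->
  forall x : 'cV[R]_d,
    dist2 x (feasible_set A b) <= L * norm2 (residual (A *m x - b)).

(* The random choice made at one iteration: inl tau is a projection onto the
   block tau of equalities, inr i a projection onto the i-th inequality. *)
Definition choice_of (ne ni : nat) : Type := ({set 'I_ne} + 'I_ni)%type.

Definition kaczmarz_step (R : realType) (ne ni d : nat)
    (A : 'M[R]_(ne + ni, d)) (b : 'cV[R]_(ne + ni))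
    (c : choice_of ne ni) (x : 'cV[R]_d) : 'cV[R]_d :=
  match c with
  | inl tau =>
      let A_tau := rowblock tau (usubmx A) in
      let b_tau := rowblock tau (usubmx b) in
      x + mp_pinv A_tau *m (b_tau - A_tau *m x)
  | inr i =>
      let a := (row (rshift ne i) A)^T in
      x - (Num.max ((a^T *m x) ord0 ord0 - b (rshift ne i) ord0) 0
             / norm2 a ^+ 2) *: a
  end.

(* c k is the choice made at iteration k.+1. *)
Fixpoint kaczmarz_iterate (R : realType) (ne ni d : nat)
    (A : 'M[R]_(ne + ni, d)) (b : 'cV[R]_(ne + ni)) (x0 : 'cV[R]_d)
    (c : nat -> choice_of ne ni) (j : nat) : 'cV[R]_d :=
  match j with
  | 0%N => x0
  | k.+1 => kaczmarz_step A b (c k) (kaczmarz_iterate A b x0 c k)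
  end.

Definition block_prob (R : realType) (ni m : nat) (beta : R) : R :=
  beta * m%:R / (ni%:R + beta * m%:R).

(* Law of one choice: a coin with parameter block_prob selects the kind of
   step, then the block, resp. the row, is uniform. *)
Definition choice_pmf (R : realType) (ne ni m : nat) (beta : R)
    (T : {set {set 'I_ne}}) (c : choice_of ne ni) : R :=
  match c with
  | inl tau => if tau \in T then block_prob ni m beta / m%:R else 0
  | inr _ => (1 - block_prob ni m beta) / ni%:R
  end.

(* Every subset of C counts as an event, so this is meant for variables with
   values in a countable discrete C. *)
Definition independent_seq (R : realType) (disp : measure_display)
    (Omega : measurableType disp) (P : probability Omega R)
    (C : Type) (xi : nat -> Omega -> C) : Prop :=
  forall (J : seq nat) (B : nat -> set C), uniq J ->
    P (\bigcap_(k in [set` J]) (xi k @^-1` B k))%classic =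
    (\prod_(k <- J) P (xi k @^-1` B k)%classic)%E.

Definition kaczmarz_choices (R : realType) (ne ni m : nat) (beta : R)
    (T : {set {set 'I_ne}}) (disp : measure_display)
    (Omega : measurableType disp) (P : probability Omega R)
    (xi : nat -> Omega -> choice_of ne ni) : Prop :=
  [/\ forall k c, measurable (xi k @^-1` [set c])%classic,
      forall k c, P (xi k @^-1` [set c])%classic = (choice_pmf m beta T c)%:E
    & independent_seq P xi].

(* Main.v *)
Require Import Defs.
From mathcomp Require Import all_boot all_order all_algebra.
From mathcomp Require Import all_classical all_reals all_analysis.
From mathcomp Require Import measurable_realfun ring lra.

Import Order.TTheory GRing.Theory Num.Theory.

Local Open Scope ring_scope.

(** One step, applied to any state [x], shrinks the squared distance to the
    feasible set [S] on average by the factor [1 - 1 / (L^2 D)], where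
    [D = ni + beta m]; independence then lets this factor be iterated.

    For a single step the key facts are the following.  Every step is Fejer
    monotone ([kaczmarz_step_fejer]): it is an orthogonal projection onto a
    convex set containing [S], so the squared distance to each point of [S],
    and hence to [S], drops by at least the squared length of the step.  The
    length is controlled from below by the residual: for a half-space it is
    the residual ([halfspace_step_length]), for a block its square is at least
    [1 / beta] times the squared residual ([block_step_length]), because the
    block residual is the image of the step under a matrix of squared operator
    norm at most [beta].  The probabilities are tuned so that on average these
    contributions add up to [1 / D] times the squared norm of the whole
    residual, and the Hoffman bound turns this into a multiple of the squared
    distance ([kaczmarz_mean_decrease]).

    Bounding the operator norm by [lambda_max], the supremum of the
    eigenvalues, requires that the Rayleigh quotients of a symmetric matrix
    lie below its largest eigenvalue ([rayleigh_le_lambda_max]).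

    For the iteration, the state at time [k] is determined by the choices made
    before [k], so it is independent of the choice made at time [k].
    Conditioning on that choice, one of finitely many, is a finite sum
    ([integral_recursionS]), and the one-step bound can be applied under the
    integral ([integral_recursion_contraction]). *)

(** * Euclidean geometry of column vectors *)

Definition dot {R : realType} {k : nat} (u v : 'cV[R]_k) : R :=
  \sum_(i < k) u i ord0 * v i ord0.

Lemma dotC {R : realType} {k : nat} (u v : 'cV[R]_k) : dot u v = dot v u.
Proof. by apply: eq_bigr => i _; rewrite mulrC. Qed.

Lemma dotDl {R : realType} {k : nat} (u v w : 'cV[R]_k) :
  dot (u + v) w = dot u w + dot v w.
Proof. by rewrite -big_split; apply: eq_bigr => i _; rewrite mxE mulrDl. Qed.

Lemma dotZl {R : realType} {k : nat} (a : R) (u v : 'cV[R]_k) :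
  dot (a *: u) v = a * dot u v.
Proof. by rewrite mulr_sumr; apply: eq_bigr => i _; rewrite mxE mulrA. Qed.

Lemma dotBl {R : realType} {k : nat} (u v w : 'cV[R]_k) :
  dot (u - v) w = dot u w - dot v w.
Proof. by rewrite dotDl -scaleN1r dotZl mulN1r. Qed.

Lemma dotZr {R : realType} {k : nat} (a : R) (u v : 'cV[R]_k) :
  dot u (a *: v) = a * dot u v.
Proof. by rewrite dotC dotZl dotC. Qed.

Lemma dotBr {R : realType} {k : nat} (u v w : 'cV[R]_k) :
  dot u (v - w) = dot u v - dot u w.
Proof. by rewrite dotC dotBl !(dotC u). Qed.

Lemma dot_mulmx {R : realType} {k : nat} (u v : 'cV[R]_k) :
  dot u v = (u^T *m v) ord0 ord0.
Proof. by rewrite mxE; apply: eq_bigr => i _; rewrite mxE. Qed.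

Lemma dot_mulmxr {R : realType} {k l : nat} (M : 'M[R]_(k, l))
    (u : 'cV[R]_k) (v : 'cV[R]_l) : dot u (M *m v) = dot (M^T *m u) v.
Proof. by rewrite !dot_mulmx trmx_mul trmxK mulmxA. Qed.

Lemma dot_ge0 {R : realType} {k : nat} (u : 'cV[R]_k) : 0 <= dot u u.
Proof. by apply: sumr_ge0 => i _; rewrite -expr2 sqr_ge0. Qed.

Lemma dot_eq0 {R : realType} {k : nat} (u : 'cV[R]_k) :
  (dot u u == 0) = (u == 0).
Proof.
apply/idP/eqP => [|->]; last by rewrite -(scale0r 0) dotZl mul0r.
rewrite psumr_eq0 => [/allP h|i _]; last by rewrite -expr2 sqr_ge0.
apply/colP => i; have /= := h i (mem_index_enum i).
by rewrite !mxE mulf_eq0 orbb => /eqP.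
Qed.

Lemma norm2_sqr {R : realType} {k : nat} (u : 'cV[R]_k) :
  norm2 u ^+ 2 = dot u u.
Proof.
rewrite sqr_sqrtr; last by apply: sumr_ge0 => i _; rewrite sqr_ge0.
by apply: eq_bigr => i _; rewrite expr2.
Qed.

Lemma norm2_ge0 {R : realType} {k : nat} (u : 'cV[R]_k) : 0 <= norm2 u.
Proof. exact: sqrtr_ge0. Qed.

(** * Rayleigh quotients *)

(** Provides both a first upper bound for the Rayleigh quotients and, applied
    to an inverse, a lower bound for an invertible positive form. *)
Lemma quadratic_form_bounded {R : realType} {k : nat} (N : 'M[R]_k) :
  exists2 K : R, 0 < K & forall u : 'cV[R]_k, dot u (N *m u) <= K * dot u u.
Proof.
exists (\sum_(i < k) \sum_(j < k) `|N i j| + 1).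
  by rewrite ltr_wpDl // sumr_ge0 // => i _; rewrite sumr_ge0.
move=> u; rewrite mulrDl mul1r -[leLHS]addr0 lerD ?dot_ge0 // mulr_suml.
apply: ler_sum => i _; rewrite mxE mulr_sumr mulr_suml; apply: ler_sum => j _.
have coord l : u l ord0 ^+ 2 <= dot u u.
  rewrite /dot (bigD1 l) //= -expr2 lerDl.
  by apply: sumr_ge0 => l' _; rewrite -expr2 sqr_ge0.
rewrite mulrCA; apply: (le_trans (ler_norm _)); rewrite normrM.
apply: ler_wpM2l => //; rewrite ler_norml.
have := coord i; have := coord j.
have := sqr_ge0 (u i ord0 + u j ord0); have := sqr_ge0 (u i ord0 - u j ord0).
by move: (dot u u) => q; nra.
Qed.

(** The least [c0] with [c0 - M] positive semidefinite is an eigenvalue: otherwise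
    [N = c0 - M] is invertible, and expanding [0 <= dot v (N *m v)] at
    [v = u - t N^-1 u] bounds [N] below by a positive multiple of the
    identity, so that [c0] could be decreased. *)
Lemma rayleigh_le_lambda_max {R : realType} {k : nat} (M : 'M[R]_k)
    (u : 'cV[R]_k) :
  M^T = M -> dot u (M *m u) <= lambda_max M * dot u u.
Proof.
move=> symM; case: k => [|k] in M u symM *.
  by rewrite /dot !big_ord0 mulr0.
pose U := [set c : R | forall v, dot v (M *m v) <= c * dot v v]%classic.
have U0 : (U !=set0)%classic.
  by have [K _ KP] := quadratic_form_bounded M; exists K.
have quot c v : v != 0 -> U c -> dot v (M *m v) / dot v v <= c.
  by move=> v0 Uc; rewrite ler_pdivrMr ?Uc // lt_def dot_eq0 v0 dot_ge0.
have lbU : has_lbound U.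
  have e0 : const_mx 1 != 0 :> 'cV[R]_k.+1.
    by apply/eqP => /matrixP/(_ ord0 ord0)/eqP; rewrite !mxE oner_eq0.
  by exists (dot (const_mx 1) (M *m const_mx 1)
            / dot (const_mx 1) (const_mx 1 : 'cV[R]_k.+1)) => c; exact: quot.
pose c0 := inf U.
have Uc0 : U c0.
  move=> v; have [->|v0] := eqVneq v 0.
    by rewrite mulmx0 -(scale0r 0) !dotZl !mul0r mulr0.
  rewrite -ler_pdivrMr ?lt_def ?dot_eq0 ?v0 ?dot_ge0 //.
  by apply: lb_le_inf => // c; exact: quot.
have ub_eig : ubound [set a : R | eigenvalue M a]%classic c0.
  move=> a /eigenvalueP[v vM v0].
  have := Uc0 v^T; rewrite -{1}symM -trmx_mul vM linearZ /= dotZr.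
  by rewrite ler_pM2r // lt_def dot_eq0 dot_ge0 trmx_eq0 v0.
have eig : eigenvalue M c0.
  apply: contraT; rewrite negbK kermx_eq0 row_free_unit => uN.
  pose N := c0%:M - M.
  have {}uN : N \in unitmx by rewrite /N -opprB -scaleN1r unitmxZ ?unitrN1.
  have symN : N^T = N by rewrite /N linearB /= tr_scalar_mx symM.
  have qN v : dot v (N *m v) = c0 * dot v v - dot v (M *m v).
    by rewrite mulmxBl dotBr mul_scalar_mx dotZr.
  have [K K0 KP] := quadratic_form_bounded (invmx N).
  have lowN v : K^-1 * dot v v <= dot v (N *m v).
    pose y := invmx N *m v.
    have Ny : N *m y = v by rewrite mulmxA mulmxV // mul1mx.
    have yv : dot y (N *m v) = dot v v by rewrite dot_mulmxr symN Ny.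
    have := Uc0 (v - K^-1 *: y); rewrite -subr_ge0 -qN.
    rewrite mulmxBr -scalemxAr Ny dotBr !dotBl !dotZr !dotZl yv.
    have := KP v; rewrite -/y [dot v y]dotC -(ler_pM2l (x := K^-1 * K^-1)).
      rewrite -(mulrA _ _ (K * _)) (mulKf (lt0r_neq0 K0)) -mulrA.
      move: (K^-1) => t; move: (dot v v) (dot y v) (dot v (N *m v)).
      by move=> p q r; lra.
    by rewrite mulr_gt0 // invr_gt0.
  have /(ge_inf lbU) : U (c0 - K^-1).
    by move=> v; have := lowN v; rewrite qN mulrBl; lra.
  by rewrite -/c0 lerBrDr gerDl invr_le0 leNgt K0.
apply: (le_trans (Uc0 u)); rewrite ler_wpM2r ?dot_ge0 //.
by apply: ub_le_sup => //; exists c0.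
Qed.

(** Passing from [M^T] to [M], a matrix and its transpose having the same
    operator norm: expand [0 <= dot z z] at [v - beta^-1 M^T M v]. *)
Lemma dot_mulmx_le {R : realType} {k l : nat} (M : 'M[R]_(k, l)) (beta : R)
    (v : 'cV[R]_l) :
  0 < beta -> lambda_max (M *m M^T) <= beta ->
  dot (M *m v) (M *m v) <= beta * dot v v.
Proof.
move=> beta0 Mbeta; set w := M *m v.
have MTw : dot (M^T *m w) (M^T *m w) <= beta * dot w w.
  rewrite dot_mulmxr trmxK mulmxA dotC.
  apply: le_trans (rayleigh_le_lambda_max _ _ _) _.
    by rewrite trmx_mul trmxK.
  by rewrite ler_wpM2r ?dot_ge0.
have := dot_ge0 (v - beta^-1 *: (M^T *m w)).
rewrite dotBr !dotBl !dotZr !dotZl (dotC v) -dot_mulmxr -/w.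
move: MTw; rewrite -(ler_pM2l (x := beta^-1 * beta^-1)).
  rewrite -(mulrA _ _ (beta * _)) (mulKf (lt0r_neq0 beta0)) => h1 h2.
  rewrite -ler_pdivrMl //; lra.
by rewrite mulr_gt0 // invr_gt0.
Qed.

(** * Distance to a set *)

Lemma dist2_has_lbound {R : realType} {k : nat} (x : 'cV[R]_k)
    (S : set 'cV[R]_k) :
  has_lbound [set norm2 (x - y) | y in S]%classic.
Proof. by exists 0 => _ [y _ <-]; exact: norm2_ge0. Qed.

Lemma dist2_ge0 {R : realType} {k : nat} (x : 'cV[R]_k) (S : set 'cV[R]_k) :
  (S !=set0)%classic -> 0 <= dist2 x S.
Proof.
case=> y Sy; apply: lb_le_inf; first by exists (norm2 (x - y)), y.
by move=> _ [z _ <-]; exact: norm2_ge0.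
Qed.

(** The comparison holds at every point of [S], hence for the infimum, whether
    or not it is attained. *)
Lemma dist2_sqr_decrease {R : realType} {k : nat} (x x' : 'cV[R]_k)
    (S : set 'cV[R]_k) (e : R) :
  (S !=set0)%classic -> 0 <= e ->
  (forall y, S y -> dot (x' - y) (x' - y) + e <= dot (x - y) (x - y)) ->
  dist2 x' S ^+ 2 + e <= dist2 x S ^+ 2.
Proof.
move=> S0 e0 closer; have de0 : 0 <= dist2 x' S ^+ 2 + e.
  by rewrite addr_ge0 // sqr_ge0.
rewrite -(sqr_sqrtr de0) ler_pXn2r ?nnegrE ?sqrtr_ge0 ?dist2_ge0 //.
apply: lb_le_inf => [|_ [y Sy <-]].
  by case: S0 => y Sy; exists (norm2 (x - y)), y.
rewrite -(ler_pXn2r (n := 2)) ?nnegrE ?sqrtr_ge0 // sqr_sqrtr // norm2_sqr.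
apply: le_trans (closer y Sy); rewrite lerD2r -norm2_sqr.
rewrite ler_pXn2r ?nnegrE ?dist2_ge0 ?norm2_ge0 //.
by apply: ge_inf; [exact: dist2_has_lbound | exists y].
Qed.

(** * One Kaczmarz step *)

(** [mp_pinv M *m M] is the orthogonal projection onto the row space of [M], so
    this is Pythagoras. *)
Lemma mp_pinv_pythagoras {R : realType} {n d : nat} (M : 'M[R]_(n, d))
    (v : 'cV[R]_d) :
  let z := mp_pinv M *m (M *m v) in
  dot (v - z) (v - z) + dot z z = dot v v.
Proof.
have [_ XMX _ symXM] := mp_pinvP M.
rewrite /= mulmxA; set Q := mp_pinv M *m M in symXM *.
have zz : dot (Q *m v) (Q *m v) = dot v (Q *m v).
  by rewrite dot_mulmxr symXM mulmxA /Q mulmxA XMX dotC.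
by rewrite dotBr !dotBl [dot (Q *m v) v]dotC zz; ring.
Qed.

Section KaczmarzStep.
Variables (R : realType) (ne ni d : nat).
Variables (A : 'M[R]_(ne + ni, d)) (b : 'cV[R]_(ne + ni)).
Local Notation S := (feasible_set A b).
Local Notation step := (kaczmarz_step A b).

Lemma usubmx_feasible (y : 'cV[R]_d) : S y -> usubmx A *m y = usubmx b.
Proof.
move=> [Sy _]; apply/colP => i; have := Sy i.
by rewrite mul_usub_mx !mxE.
Qed.

Lemma rowblock_mul (tau : {set 'I_ne}) (M : 'M[R]_(ne, d)) (x : 'cV[R]_d) :
  rowblock tau M *m x = rowblock tau (M *m x).
Proof. by rewrite /rowblock mul_rowsub_mx. Qed.

Lemma dsubmx_rowE (i : 'I_ni) (x : 'cV[R]_d) :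
  ((row (rshift ne i) A)^T^T *m x) ord0 ord0 = (A *m x) (rshift ne i) ord0.
Proof. by rewrite trmxK -row_mul mxE. Qed.

(** Pythagoras for a block, where [y] lies in the affine space projected onto;
    for a half-space the angle at the projection is obtuse, whence an
    inequality. *)
Lemma kaczmarz_step_fejer (c : choice_of ne ni) (x y : 'cV[R]_d) :
  standardized A -> S y ->
  dot (step c x - y) (step c x - y) + dot (step c x - x) (step c x - x)
  <= dot (x - y) (x - y).
Proof.
move=> A1 Sy; case: c => [tau|i] /=.
  set M := rowblock tau _.
  have -> : rowblock tau (usubmx b) - M *m x = M *m (y - x).
    by rewrite mulmxBr [M *m y]rowblock_mul (usubmx_feasible y).
  set z := mp_pinv M *m _; have := mp_pinv_pythagoras M (y - x).
  rewrite /= -/z => pyth.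
  have neg : x - y + z = (-1) *: (y - x - z).
    by rewrite scaleN1r !opprB addrC; congr (_ + _); rewrite addrC.
  have neg' : x - y = (-1) *: (y - x) by rewrite scaleN1r opprB.
  by rewrite !(addrAC x z) subrr add0r neg neg' !dotZl !dotZr -pyth; lra.
set a := (row _ A)^T; have aa : norm2 a = 1 by exact: A1.
rewrite aa expr1n divr1 dsubmx_rowE; set t := Num.max _ _.
have Ey u : dot a u = (A *m u) (rshift ne i) ord0.
  by rewrite dot_mulmx dsubmx_rowE.
have t0 : 0 <= t by rewrite le_max lexx orbT.
have tP : t * (dot a (x - y) - t) >= 0.
  rewrite dotBr !Ey; have := Sy.2 i; move: ((A *m y) _ _) => ay ayb.
  rewrite /t /Num.max; case: ltP => [|h]; first by rewrite mul0r.
  by rewrite mulr_ge0 // ; lra.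
have -> : x - t *: a - y = (x - y) - t *: a by rewrite addrAC.
have -> : x - t *: a - x = (-t) *: a by rewrite addrAC subrr add0r scaleNr.
move: (x - y) tP => w tP.
rewrite dotBr !dotBl !dotZr !dotZl [dot w a]dotC -(norm2_sqr a) aa; nra.
Qed.

(** The step solves the equations of the block, so the residual of the block
    is, up to sign, the image of the step under the block of [A]. *)
Lemma block_step_length (tau : {set 'I_ne}) (beta : R) (x : 'cV[R]_d) :
  (S !=set0)%classic -> 0 < beta ->
  lambda_max (rowblock tau (usubmx A) *m (rowblock tau (usubmx A))^T)
    <= beta ->
  \sum_(i in tau) (residual (A *m x - b) (lshift ni i) ord0) ^+ 2
  <= beta * dot (step (inl tau) x - x) (step (inl tau) x - x).
Proof.
move=> [y Sy] beta0 tau_beta /=.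
rewrite [x + _ - x]addrAC subrr add0r.
apply: le_trans (dot_mulmx_le _ _ _ beta0 tau_beta).
have [MXM _ _ _] := mp_pinvP (rowblock tau (usubmx A)).
rewrite -(usubmx_feasible y Sy) -rowblock_mul -mulmxBr !mulmxA MXM.
rewrite mulmxBr !rowblock_mul (usubmx_feasible y) // mul_usub_mx big_enum_val.
apply: ler_sum => k _; rewrite /residual col_mxEu !mxE expr2.
by rewrite -mulrNN !opprB.
Qed.

Lemma halfspace_step_length (i : 'I_ni) (x : 'cV[R]_d) :
  standardized A ->
  dot (step (inr i) x - x) (step (inr i) x - x)
  = (residual (A *m x - b) (rshift ne i) ord0) ^+ 2.
Proof.
move=> A1; rewrite /kaczmarz_step (A1 (rshift ne i)) expr1n divr1 dsubmx_rowE.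
rewrite addrAC subrr add0r -scaleNr dotZl dotZr -norm2_sqr A1.
by rewrite /residual col_mxEd !mxE; ring.
Qed.

Lemma residual_sqr (y : 'cV[R]_(ne + ni)) (m : nat) (beta : R)
    (T : {set {set 'I_ne}}) :
  row_paving (usubmx A) m beta T ->
  norm2 (residual y) ^+ 2 =
  \sum_(tau in T) \sum_(i in tau) (residual y (lshift ni i) ord0) ^+ 2
  + \sum_(i < ni) (residual y (rshift ne i) ord0) ^+ 2.
Proof.
case=> partT _ _; rewrite norm2_sqr /dot big_split_ord /=.
rewrite -(set_partition_big _ partT) /=.
by congr (_ + _); apply: eq_big => i; rewrite ?inE // expr2.
Qed.

(** A block contains a unit row, whose squared norm is a diagonal entry of the
    Gram matrix of the block.  This makes [beta] positive, hence usable as a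
    divisor. *)
Lemma paving_bound_ge1 (m : nat) (beta : R) (T : {set {set 'I_ne}})
    (tau : {set 'I_ne}) :
  standardized A -> row_paving (usubmx A) m beta T -> tau \in T -> 1 <= beta.
Proof.
move=> A1 [partT _ T_beta] tauT; apply: le_trans (T_beta _ tauT).
have [i itau] : exists i, i \in tau.
  by apply/set0Pn; apply: contraTneq tauT => ->; case/and3P: partT.
set M := rowblock tau _; pose k := enum_rank_in itau i.
pose e : 'cV[R]_#|tau| := delta_mx k 0.
have ee : dot e e = 1.
  by rewrite dot_mulmx trmx_delta mul_delta_mx_cond eqxx mulr1n mxE eqxx.
have := rayleigh_le_lambda_max (M *m M^T) e.
rewrite ee mulr1 -mulmxA dot_mulmxr.
have -> : M^T *m e = (row (lshift ni i) A)^T.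
  rewrite -[e]trmxK -trmx_mul trmx_delta -rowE; congr (_^T); apply/rowP => l.
  by rewrite !mxE enum_rankK_in.
by rewrite -norm2_sqr A1 expr1n; apply; rewrite trmx_mul trmxK.
Qed.

(** Both kinds of step have probability [1 / D] per unit of squared length, with
    [D = ni + beta m]: a block is drawn with probability [beta / D] and has
    length at least [1 / beta] times its residual, a half-space with
    probability [1 / D] and length exactly its residual.  The expected
    squared length is thus at least [1 / D] times the whole squared residual,
    which the Hoffman bound compares to the distance. *)
Lemma kaczmarz_mean_decrease (m : nat) (beta L : R) (T : {set {set 'I_ne}})
    (x : 'cV[R]_d) :
  standardized A -> (S !=set0)%classic -> row_paving (usubmx A) m beta T ->
  hoffman_constant A L ->
  (forall c : choice_of ne ni, 0 <= choice_pmf m beta T c :> R) ->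
  \sum_(c : {set 'I_ne} + 'I_ni) choice_pmf m beta T c = 1 :> R ->
  \sum_(c : {set 'I_ne} + 'I_ni)
      choice_pmf m beta T c * dist2 (step c x) S ^+ 2
  <= (1 - 1 / (L ^+ 2 * (ni%:R + beta * m%:R))) * dist2 x S ^+ 2.
Proof.
move=> A1 S0 pavT hL p_ge0 p_sum1; set D := ni%:R + beta * m%:R.
pose len c := dot (step c x - x) (step c x - x).
have [_ cardT T_beta] := pavT.
have beta_ge1 tau : tau \in T -> 1 <= beta by exact: paving_bound_ge1 pavT.
have m0 tau : tau \in T -> 0 < m%:R :> R.
  by move=> tauT; rewrite ltr0n -cardT; apply/card_gt0P; exists tau.
have betam_ge0 : 0 <= beta * m%:R.
  have [T0|[tau tauT]] := set_0Vmem T; first by rewrite -cardT T0 cards0 mulr0.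
  by rewrite mulr_ge0 // (le_trans ler01) // (beta_ge1 tau).
have ni_gt0 (i : 'I_ni) : 0 < ni%:R :> R.
  by rewrite ltr0n (leq_ltn_trans _ (ltn_ord i)).
have D_inl tau : tau \in T -> 0 < D.
  move=> tauT; rewrite ltr_wpDl // mulr_gt0 // ?(m0 tau) //.
  by rewrite (lt_le_trans ltr01) ?(beta_ge1 tau).
have D_inr (i : 'I_ni) : 0 < D by rewrite ltr_pwDl // ni_gt0.
have p_inl tau : tau \in T ->
    choice_pmf (ni := ni) m beta T (inl tau) = beta / D.
  move=> tauT; rewrite /choice_pmf tauT /block_prob -/D.
  by field; rewrite !lt0r_neq0 ?(m0 tau) ?(D_inl tau).
have p_inr (i : 'I_ni) : choice_pmf m beta T (inr i) = 1 / D.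
  have [Dn0 ni0] := (lt0r_neq0 (D_inr i), lt0r_neq0 (ni_gt0 i)).
  rewrite /choice_pmf /block_prob -/D.
  have -> : 1 - beta * m%:R / D = ni%:R / D.
    by rewrite -{1}(divff Dn0) -mulrBl /D addrK.
  by rewrite mulrAC divff.
have D_ge0 : 0 <= D by rewrite addr_ge0.
have decrease c : dist2 (step c x) S ^+ 2 + len c <= dist2 x S ^+ 2.
  apply: dist2_sqr_decrease => // [|y Sy]; first exact: dot_ge0.
  exact: kaczmarz_step_fejer.
have mean_len : norm2 (residual (A *m x - b)) ^+ 2 / D
    <= \sum_(c : {set 'I_ne} + 'I_ni) choice_pmf m beta T c * len c.
  rewrite (residual_sqr _ _ _ _ pavT) mulrDl big_sumType lerD //.
    rewrite mulr_suml [leRHS](bigID (mem T)) -[leLHS]addr0 lerD //.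
      apply: ler_sum => tau tauT; rewrite p_inl // mulrAC.
      rewrite ler_wpM2r ?invr_ge0 ?(ltW (D_inl _ tauT)) //.
      apply: block_step_length => //; last exact: T_beta.
      exact: lt_le_trans ltr01 (beta_ge1 _ tauT).
    by apply: sumr_ge0 => tau _; rewrite mulr_ge0 ?p_ge0 ?dot_ge0.
  rewrite mulr_suml; apply: ler_sum => i _.
  by rewrite p_inr /len halfspace_step_length // mul1r mulrC.
have hoffman : dist2 x S ^+ 2 / (L ^+ 2 * D)
    <= norm2 (residual (A *m x - b)) ^+ 2 / D.
  (* With L = 0 the left-hand side is 0, an inverse of 0 being 0. *)

  have [->|L0] := eqVneq L 0.
    by rewrite expr0n mul0r invr0 mulr0 mulr_ge0 ?sqr_ge0 ?invr_ge0.
  rewrite invfM mulrA ler_wpM2r ?invr_ge0 // ler_pdivrMr ?exprn_even_gt0 //.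
  have dLr := hL b S0 x; have d0 := dist2_ge0 x _ S0.
  by rewrite mulrC -exprMn ler_pXn2r ?nnegrE // (le_trans d0).
apply: (@le_trans _ _ (\sum_(c : {set 'I_ne} + 'I_ni)
    (choice_pmf m beta T c * dist2 x S ^+ 2 - choice_pmf m beta T c * len c))).
  by apply: ler_sum => c _; rewrite -mulrBr ler_wpM2l ?p_ge0 // lerBrDr.
rewrite sumrB -mulr_suml p_sum1 mul1r mulrBl !mul1r lerD2l lerN2 mulrC.
exact: le_trans hoffman mean_len.
Qed.

End KaczmarzStep.

(** * Random recursions driven by finite independent noise *)

Section RandomRecursion.
Context {R : realType} {disp : measure_display} {Omega : measurableType disp}.
Variables (P : probability Omega R) (C : finType) (X : Type).
Variables (xi : nat -> Omega -> C) (f : C -> X -> X) (x0 : X).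
Variable Z : nat -> Omega -> X.
Hypothesis xi_measurable : forall k c, measurable (xi k @^-1` [set c])%classic.
Hypothesis xi_indep : independent_seq P xi.
Hypothesis Z0 : forall w, Z 0 w = x0.
Hypothesis ZS : forall k w, Z k.+1 w = f (xi k w) (Z k w).

Lemma preimage_xi_measurable (k : nat) (B : set C) :
  measurable (xi k @^-1` B)%classic.
Proof.
have -> : (xi k @^-1` B = \bigcup_(c in B) (xi k @^-1` [set c]))%classic.
  by apply/seteqP; split => [w Bw|w [c Bc /=]]; [exists (xi k w)|move=> ->].
by apply: fin_bigcup_measurable => [|c _]; [exact: finite_finset|].
Qed.

(** Only finitely many values of the noise occur, so the state takes finitely
    many values and arbitrary sets of states have measurable preimages. *)
Lemma preimage_recursion_measurable (k : nat) (B : set X) :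
  measurable (Z k @^-1` B)%classic.
Proof.
elim: k B => [|k IH] B.
  have [Bx0|nBx0] := pselect (B x0).
    rewrite (_ : _ @^-1` _ = setT)%classic; first exact: measurableT.
    by apply/seteqP; split => // w _ /=; rewrite Z0.
  rewrite (_ : _ @^-1` _ = set0)%classic; first exact: measurable0.
  by apply/seteqP; split => // w /=; rewrite Z0.
have -> : (Z k.+1 @^-1` B = \bigcup_(c in [set: C])
    (xi k @^-1` [set c] `&` Z k @^-1` (f c @^-1` B)))%classic.
  apply/seteqP; split => [w /=|w [c _ [/= xic]]]; rewrite ZS.
    by move=> Bw; exists (xi k w).
  by rewrite xic.
apply: fin_bigcup_measurable => [|c _]; first exact: finite_finset.
by apply: measurableI => //; exact: IH.
Qed.

Lemma recursion_measurable_fun (k : nat) (g : X -> R) (D : set Omega) :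
  measurable_fun D (fun w => (g (Z k w))%:E).
Proof.
apply: (@measurable_funS _ _ _ _ setT) => //.
move=> _ B _; rewrite setTI.
exact: (preimage_recursion_measurable k (fun x => B (g x)%:E)).
Qed.

Lemma integral_split_choice (k : nat) (D : set Omega) (g : X -> R) :
  measurable D -> (forall x, 0 <= g x) ->
  (\int[P]_(w in D) (g (Z k.+1 w))%:E
   = \sum_(c : C)
       \int[P]_(w in D `&` xi k @^-1` [set c]) (g (f c (Z k w)))%:E)%E.
Proof.
move=> mD g0.
pose F c := (D `&` xi k @^-1` [set c])%classic.
have DF : D = (\big[setU/set0]_(c <- index_enum C) F c)%classic.
  rewrite -bigcup_seq; apply/seteqP; split => [w Dw|w [c _ []]//].
  by exists (xi k w) => //=; rewrite mem_index_enum.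
rewrite [in LHS]DF ge0_integral_bigsetU.
- apply: eq_bigr => c _; apply: eq_integral => w.
  by rewrite inE => -[_ /= xic]; rewrite ZS xic.
- by move=> c; exact: measurableI.
- exact: index_enum_uniq.
- by move=> c c' _ _ [w [[_ /= <-] [_ /= <-]]].
- exact: recursion_measurable_fun.
- by move=> w _; rewrite lee_fin.
Qed.

Local Notation cyl J B := (\bigcap_(k in [set` J]) (xi k @^-1` B k))%classic.

Lemma cyl_measurable (J : seq nat) (B : nat -> set C) : measurable (cyl J B).
Proof.
by apply: fin_bigcap_measurable => // k _; exact: preimage_xi_measurable.
Qed.

Lemma cyl_cons (k : nat) (J : seq nat) (B : nat -> set C) :
  cyl (k :: J) B = (xi k @^-1` B k `&` cyl J B)%classic.
Proof.
rewrite -(bigcap_setU1 (fun i => xi i @^-1` B i)%classic) //.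
congr bigcap; apply/seteqP; split => i /=; rewrite inE.
  by move=> /orP[/eqP|]; [left|right].
by move=> -[->|->]; rewrite ?eqxx ?orbT.
Qed.

(** The [k]th state depends on the noise before [k] only.  The cylinders range
    over several later times because one induction step moves the noise of
    time [k] into the conditioning event. *)
Lemma integral_cyl_recursion (k : nat) (J : seq nat) (B : nat -> set C)
    (g : X -> R) :
  uniq J -> all (leq k) J -> (forall x, 0 <= g x) ->
  (\int[P]_(w in cyl J B) (g (Z k w))%:E
   = P (cyl J B) * \int[P]_w (g (Z k w))%:E)%E.
Proof.
elim: k J B g => [|k IH] J B g uJ kJ g0.
  under eq_integral do rewrite Z0.
  under [in RHS]eq_integral do rewrite Z0.
  rewrite integral_cst; last exact: cyl_measurable.
  by rewrite integral_cst //= probability_setT mule1 muleC.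
have kJ' : k \notin J by apply/negP => /(allP kJ); rewrite ltnn.
have all_k : all (leq k) J by apply: sub_all kJ => i; exact: ltnW.
have split_c c :
    (\int[P]_(w in cyl J B `&` xi k @^-1` [set c]) (g (f c (Z k w)))%:E
     = P (cyl J B)
       * \int[P]_(w in setT `&` xi k @^-1` [set c]) (g (f c (Z k w)))%:E)%E.
  (* B' turns both domains into cylinders starting at time k. *)
  pose B' i := if i == k then [set c]%classic else B i.
  have EJ : cyl J B' = cyl J B.
    apply: eq_bigcapr => i /= iJ; rewrite /B'.
    by case: eqVneq iJ => // ->; rewrite (negPf kJ').
  have Ek : (xi k @^-1` B' k = xi k @^-1` [set c])%classic.
    by rewrite /B' eqxx.
  have IHc J' : uniq J' -> all (leq k) J' ->
      (\int[P]_(w in cyl J' B') (g (f c (Z k w)))%:E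
       = P (cyl J' B') * \int[P]_w (g (f c (Z k w)))%:E)%E.
    by move=> uJ' kJ''; exact: (IH J' B' (g \o f c) uJ' kJ'' (fun x => g0 _)).
  have Ek1 : (xi k @^-1` B' k = cyl [:: k] B')%classic.
    by rewrite cyl_cons set_nil bigcap_set0 setIT.
  rewrite setTI setIC -EJ -Ek -cyl_cons Ek1 !IHc /= ?kJ' ?leqnn //.
  rewrite !xi_indep //= ?kJ' // !big_cons big_nil mule1.
  by rewrite muleA [in RHS](muleC (\prod_(i <- J) _)%E).
rewrite integral_split_choice //; last exact: cyl_measurable.
rewrite integral_split_choice // ge0_sume_distrr; last first.
  by move=> c _; apply: integral_ge0 => w _; rewrite lee_fin.
by apply: eq_bigr => c _; exact: split_c.
Qed.

Lemma integral_recursionS (k : nat) (g : X -> R) :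
  (forall x, 0 <= g x) ->
  (\int[P]_w (g (Z k.+1 w))%:E
   = \sum_(c : C) P (xi k @^-1` [set c])%classic
                  * \int[P]_w (g (f c (Z k w)))%:E)%E.
Proof.
move=> g0; rewrite integral_split_choice //; apply: eq_bigr => c _.
have := integral_cyl_recursion k [:: k] (fun=> [set c]%classic) (g \o f c).
rewrite cyl_cons set_nil bigcap_set0 setIT setTI /=; apply => //.
by rewrite leqnn.
Qed.

Lemma noise_law_sum1 (k : nat) :
  (\sum_(c : C) P (xi k @^-1` [set c])%classic = 1)%E.
Proof.
have := integral_split_choice k setT (fun=> 1) measurableT (fun=> ler01).
rewrite integral_cst //= mul1e probability_setT => total; rewrite [RHS]total.
by apply: eq_bigr => c _; rewrite setTI integral_cst //= mul1e.
Qed.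

Lemma integral_recursion_contraction (p : C -> R) (g : X -> R) (rho : R)
    (k : nat) :
  (forall k c, P (xi k @^-1` [set c])%classic = (p c)%:E) ->
  (forall x, 0 <= g x) -> 0 <= rho ->
  (forall x, \sum_(c : C) p c * g (f c x) <= rho * g x) ->
  (\int[P]_w (g (Z k w))%:E <= (rho ^+ k * g x0)%:E)%E.
Proof.
move=> xi_law g0 rho0 contr; elim: k => [|k IH].
  under eq_integral do rewrite Z0.
  by rewrite integral_cst //= probability_setT mule1 expr0 mul1r.
have p0 c : 0 <= p c by rewrite -lee_fin -(xi_law 0%N c) measure_ge0.
rewrite integral_recursionS //.
apply: (@le_trans _ _ (\int[P]_w (rho%:E * (g (Z k w))%:E))%E); last first.
  rewrite ge0_integralZl_EFin //.
  - by rewrite exprS -mulrA EFinM lee_wpmul2l // lee_fin.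
  - by move=> w _; rewrite lee_fin.
  - exact: recursion_measurable_fun.
under eq_bigr => c _.
  rewrite xi_law -ge0_integralZl_EFin //; last first.
  - exact: (recursion_measurable_fun k (g \o f c)).
  - by move=> w _; rewrite lee_fin.
  over.
rewrite -ge0_integral_sum //.
- apply: ge0_le_integral => //.
  + by move=> w _; apply: sume_ge0 => c _; rewrite -EFinM lee_fin mulr_ge0.
  + under eq_fun do under eq_bigr do rewrite -EFinM.
    under eq_fun do rewrite sumEFin.
    exact: (recursion_measurable_fun k (fun x => \sum_(c : C) p c * g (f c x))).
  + under eq_fun do rewrite -EFinM.
    exact: (recursion_measurable_fun k (fun x => rho * g x)).
  + move=> w _; under eq_bigr do rewrite -EFinM.
    by rewrite sumEFin -EFinM lee_fin.
- move=> c; under eq_fun do rewrite -EFinM.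
  exact: (recursion_measurable_fun k (fun x => p c * g (f c x))).
- by move=> c w _; rewrite -EFinM lee_fin mulr_ge0.
Qed.

End RandomRecursion.

(** * The convergence theorem *)

Theorem theorem2p1 (R : realType) (ne ni d m : nat)
    (A : 'M[R]_(ne + ni, d)) (b : 'cV[R]_(ne + ni))
    (beta L : R) (T : {set {set 'I_ne}}) (x0 : 'cV[R]_d)
    (disp : measure_display) (Omega : measurableType disp)
    (P : probability Omega R) (xi : nat -> Omega -> choice_of ne ni)
    (A_standardized : standardized A)
    (S_nonempty : (feasible_set A b !=set0)%classic)
    (T_paving : row_paving (usubmx A) m beta T)
    (L_hoffman : hoffman_constant A L)
    (xi_choices : kaczmarz_choices m beta T P xi)
    (j : nat) (j_gt0 : (0 < j)%N) :
  ('E_P[fun w => (dist2 (kaczmarz_iterate A b x0 (fun k => xi k w) j)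
                        (feasible_set A b) ^+ 2)%R]
   <= ((1 - 1 / (L ^+ 2 * (ni%:R + beta * m%:R))) ^+ j
       * dist2 x0 (feasible_set A b) ^+ 2)%R%:E)%E.

Proof.
have [xi_meas xi_law xi_indep] := xi_choices.
pose C : finType := ({set 'I_ne} + 'I_ni)%type.
pose S := feasible_set A b; pose g x := dist2 x S ^+ 2.
pose Z k w := kaczmarz_iterate A b x0 (fun i => xi i w) k.
have Z0 w : Z 0%N w = x0 by [].
have ZS k w : Z k.+1 w = kaczmarz_step A b (xi k w) (Z k w) by [].
set rho := 1 - _.
have p_ge0 (c : choice_of ne ni) : 0 <= choice_pmf m beta T c :> R.
  by rewrite -lee_fin -(xi_law 0%N c) measure_ge0.
have p_sum1 : \sum_(c : C) choice_pmf m beta T c = 1 :> R.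
  have := noise_law_sum1 P C _ xi (kaczmarz_step A b) x0 Z xi_meas Z0 ZS 0.
  under eq_bigr do rewrite xi_law.
  by rewrite sumEFin => -[].
have decr x : \sum_(c : C) choice_pmf m beta T c * g (kaczmarz_step A b c x)
    <= rho * g x.
  exact: kaczmarz_mean_decrease.
have g_ge0 x : 0 <= g x by exact: sqr_ge0.
rewrite unlock.
have [rho_ge0|rho_lt0] := leP 0 rho.
  exact: (integral_recursion_contraction P C _ xi (kaczmarz_step A b) x0 Z
            xi_meas xi_indep Z0 ZS (choice_pmf m beta T) g rho j xi_law).
(* A negative rate leaves only the zero function as a solution of decr. *)
have g0 x : g x = 0.
  apply/eqP; rewrite eq_le g_ge0 andbT -(ler_nM2l rho_lt0) mulr0.
  apply: le_trans (decr x); apply: sumr_ge0 => c _.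
  by rewrite mulr_ge0.
under eq_integral => w _ do rewrite [X in X%:E](g0 (Z j w)).
by rewrite integral0 [X in _ * X](g0 x0) mulr0.
Qed.
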